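(* Let $q\ge 1$ and $\ell\ge 2$ be integers and $\mathbf{t}=(t_1,\dots,t_q)$ a vector of positive integers. For all integers $n\ge \max\{\ell,\|\mathbf{t}\|_\infty+\Lambda_{\mathbf{t}}\}$, \[ \mathbf{GRT}_\ell(n\to\mathbf{t}K_2)=\max\{\phi_{\ell,n}(1,\Lambda_{\mathbf{t}}),\ \phi_{\ell,n}(2\|\mathbf{t}\|_\infty-1,\ \Lambda_{\mathbf{t}}-\|\mathbf{t}\|_\infty+1)\}. \] Moreover, $\mathbf{GRT}_\ell(n\to\mathbf{t}K_2)=0$ for $n<\ell$, and $\mathbf{GRT}_\ell(n\to\mathbf{t}K_2)=\binom{n}{\ell}$ for $\ell\le n\le \|\mathbf{t}\|_\infty+\Lambda_{\mathbf{t}}$.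
   Context: $m_\ell(G)$ denotes the number of copies of $K_\ell$ in a graph $G$. For a graph $G$, $G\to\mathbf{t}K_2$ means that every $q$-edge-colouring of $G$ contains, for some $j\in[q]$, a matching of size $t_j$ all of whose edges have colour $j$; $G\not\to\mathbf{t}K_2$ is its negation. $\mathbf{GRT}_\ell(n\to\mathbf{t}K_2)=\max\{m_\ell(G): |V(G)|=n,\ G\not\to\mathbf{t}K_2\}$. $\|\mathbf{t}\|_\infty=\max_j t_j$ and $\Lambda_{\mathbf{t}}=\sum_{i=1}^q(t_i-1)$. For integers $x,y$, $\phi_{\ell,n}(x,y)=\binom{x+y}{\ell}+\binom{y}{\ell-1}(n-x-y)$. *)

(* Defs.v *)
From mathcomp Require Import all_boot.

Set Implicit Arguments.
Unset Strict Implicit.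
Unset Printing Implicit Defensive.

Section Graphs.

Variable V : finType.

(* A simple graph on the vertex set V is given by its edge set G; an edge is
   a 2-element set of vertices. *)
Definition simple_graph (G : {set {set V}}) : bool :=
  [forall e in G, #|e| == 2].

Definition clique (G : {set {set V}}) (K : {set V}) : bool :=
  [forall x in K, forall y in K, (x != y) ==> ([set x; y] \in G)].

Definition num_cliques (l : nat) (G : {set {set V}}) : nat :=
  #|[set K : {set V} | (#|K| == l) && clique G K]|.

Definition matching (G M : {set {set V}}) : bool :=
  (M \subset G) && trivIset M.

(* Colourings are total functions on sets of vertices, but only their values
   on the edges of G matter; for q > 0 every map from the edges of G to the
   q colours extends to such a function. *)
Definition arrows (G : {set {set V}}) (q : nat) (t : 'I_q -> nat) : bool :=
  [forall c : {ffun {set V} -> 'I_q}, exists j : 'I_q,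
     exists M : {set {set V}},
       [&& matching G M, #|M| == t j & [forall e in M, c e == j]]].

End Graphs.

(* \max of an empty range is 0, but the range below is never empty when q and
   all t j are positive: it contains the graph with no edges. *)
Definition GRT (l n q : nat) (t : 'I_q -> nat) : nat :=
  \max_(G : {set {set 'I_n}} | simple_graph G && ~~ arrows G t)
    num_cliques l G.

Definition tmax (q : nat) (t : 'I_q -> nat) : nat := \max_(j < q) t j.

Definition Lambda (q : nat) (t : 'I_q -> nat) : nat := \sum_(j < q) (t j - 1).

(* The subtraction n - x - y is truncated at 0; this is the integer difference
   as soon as x + y <= n. *)
Definition phi (l n x y : nat) : nat :=
  'C(x + y, l) + 'C(y, l - 1) * (n - x - y).

(* Main.v *)
Require Import Defs.
From mathcomp Require Import all_boot zify.

Set Implicit Arguments.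
Unset Strict Implicit.
Unset Printing Implicit Defensive.

(* Let T = tmax t - 1.  A colour class j has no matching of size t j, so moving
   to a set S_j, one at a time, the vertices covered by all maximum matchings
   leaves, by Gallai's lemma, at most C(2 r_j + 1, 2) edges of that colour, where
   |S_j| + r_j <= t j - 1.  With S the union of the S_j, enlarged to have exactly
   Lambda - R vertices for R = sum_j r_j, and a = min(R, T), the graph G - S has
   at most C(R + a + 1, 2) edges.  A Kruskal-Katona bound relative to S then gives
   at most phi(2a + 1, Lambda - a) cliques, and this expression is quasiconvex in
   a, hence is maximal at a = 0 or a = T.  Conversely, phi(2a + 1, Lambda - a) is
   attained by joining Lambda - a vertices to everything and adding a clique on
   2a + 1 further vertices. *)

(** * Convexity and growth of binomial coefficients *)

(** Induction on [h]: by Pascal's rule each further shift adds a binomial of top [d + h] on the left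
    and one of the larger top [b + h] on the right. *)
Lemma bin_shift_convex m b d h :
  d <= b -> 'C(b, m) + 'C(d + h, m) <= 'C(b + h, m) + 'C(d, m).
Proof.
case: m => [|m] db; first by rewrite !bin0.
elim: h => [|h IH]; first by rewrite !addn0.
rewrite !addnS !binS.
have : 'C(d + h, m) <= 'C(b + h, m) by apply: leq_bin2l; rewrite leq_add2r.
lia.
Qed.

Lemma bin_convex m a b c d :
  a + d = b + c -> b <= a -> c <= a -> 'C(b, m) + 'C(c, m) <= 'C(a, m) + 'C(d, m).
Proof.
move=> E ba ca; have := @bin_shift_convex m b d (a - b).
rewrite (_ : d + (a - b) = c); last by lia.
by rewrite subnKC //; apply; lia.
Qed.

(** Serves the base case of the Kruskal-Katona induction, where [U] is empty while [x] is still
    arbitrary. *)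
Lemma bin_add_lower m s x : 'C(s, m.+1) + x * 'C(s, m) <= 'C(s + x, m.+1).
Proof.
elim: x => [|x IH]; first by rewrite mul0n !addn0.
have : 'C(s, m) <= 'C(s + x, m) by apply: leq_bin2l; rewrite leq_addr.
by rewrite addnS binS mulSn; lia.
Qed.

Lemma bin2_odd r : 'C(r.*2.+1, 2) = r * r.*2.+1.
Proof. by rewrite bin2odd /= ?odd_double // doubleK mulnC. Qed.

(** * Edges and cliques under deletion of a vertex *)

Section Graph.

Variables (V : finType) (G : {set {set V}}).
Hypothesis sG : simple_graph G.

Lemma edge_card e : e \in G -> #|e| = 2.
Proof. by move=> eG; apply/eqP; move/forall_inP: sG; apply. Qed.

Definition cliques_in l (U : {set V}) :=
  [set K : {set V} | [&& K \subset U, #|K| == l & clique G K]].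

Definition edges_in (U : {set V}) := [set e in G | e \subset U].

Definition nbhd v (U : {set V}) := [set w in U | [set v; w] \in G].

Lemma nbhd_irrefl v U : v \notin nbhd v U.
Proof.
by apply/negP; rewrite inE => /andP[_ /edge_card]; rewrite setUid cards1.
Qed.

Lemma card_cliques_in_le l U : #|cliques_in l U| <= 'C(#|U|, l).
Proof.
rewrite -cards_draws; apply: subset_leq_card; apply/subsetP=> K.
by rewrite !inE => /and3P[-> ->].
Qed.

Lemma card_edges_inD1 v (U : {set V}) : v \in U ->
  #|edges_in U| = #|edges_in (U :\ v)| + #|nbhd v U|.
Proof.
move=> vU; rewrite -(cardsID [set e : {set V} | v \in e]) addnC; congr (_ + _).
  by apply: eq_card => e; rewrite !inE subsetD1; case: (v \in e); rewrite ?andbF ?andbT.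
rewrite -(card_in_imset (f := fun w => [set v; w]) (D := nbhd v U)); last first.
  move=> w w' wN w'N /setP /(_ w); rewrite !inE eqxx orbT.
  case/esym/orP=> /eqP // E; by move: (nbhd_irrefl v U); rewrite -{1}E wN.
apply: eq_card => e; rewrite !inE; apply/idP/imsetP => [/andP[/andP[eG eU] ve]|].
  have /cards2P [x [y [xy E]]] : #|e| == 2 by rewrite edge_card.
  move: ve; rewrite E !inE => /orP[]/eqP vE; [exists y|exists x]; rewrite ?vE //.
  - by rewrite inE -E eG andbT (subsetP eU) // E !inE eqxx orbT.
  - by rewrite inE setUC -E eG andbT (subsetP eU) // E !inE eqxx.
  - by rewrite setUC.
case=> w; rewrite inE => /andP[wU vwG] ->.
by rewrite vwG subUset !sub1set vU wU !inE eqxx.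
Qed.

(** Removing [v] maps the cliques through [v] injectively to [l]-subsets of its neighbourhood. *)
Lemma card_cliques_inD1 l v (U : {set V}) : v \in U ->
  #|cliques_in l.+1 U| <= #|cliques_in l.+1 (U :\ v)| + 'C(#|nbhd v U|, l).
Proof.
move=> vU; rewrite -(cardsID [set e : {set V} | v \in e]) addnC; apply: leq_add.
  apply: subset_leq_card; apply/subsetP=> K.
  by rewrite !inE subsetD1 => /andP[-> /and3P[-> -> ->]].
rewrite -cards_draws -(card_in_imset (f := fun K => K :\ v)); last first.
  move=> K L; rewrite !inE => /andP[_ vK] /andP[_ vL] E.
  by rewrite -(setD1K vK) E setD1K.
apply: subset_leq_card; apply/subsetP=> _ /imsetP[K + ->].
rewrite !inE => /andP[/and3P[KU /eqP cK clK] vK]; apply/andP; split.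
  apply/subsetP=> w; rewrite !inE => /andP[wv wK]; rewrite (subsetP KU) //=.
  move/forall_inP: clK => /(_ _ vK) /forall_inP /(_ _ wK) /implyP; apply.
  by rewrite eq_sym.
by rewrite -eqSS -cK (cardsD1 v K) vK.
Qed.

(** Induction on [d]: deleting a vertex destroys at least [d.+1] edges and lowers every other degree
    by at most one. *)
Lemma edges_in_min_degree d (U : {set V}) : 0 < #|U| ->
  (forall v, v \in U -> d <= #|nbhd v U|) -> 'C(d.+1, 2) <= #|edges_in U|.
Proof.
elim: d U => [|d IH] U U0 hd; first by [].
case/card_gt0P: (U0) => v vU; rewrite (card_edges_inD1 vU).
have nbD w : w \in U -> #|nbhd w U| <= #|nbhd w (U :\ v)|.+1.
  move=> wU; apply: leq_trans (_ : #|v |: nbhd w (U :\ v)| <= _).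
    apply: subset_leq_card; apply/subsetP=> z; rewrite !inE.
    by case: (z == v).
  by rewrite cardsU1; case: (_ \notin _).
have := IH (U :\ v); have := hd v vU.
have : d.+1 <= #|U :\ v|.
  apply: leq_trans (hd _ vU) _; apply: subset_leq_card; apply/subsetP=> z zN.
  rewrite !inE; move: (zN); rewrite inE => /andP[-> _]; rewrite andbT.
  by apply: contraTneq zN => ->; apply: nbhd_irrefl.
move=> h1 h2 h3; rewrite binS bin1.
apply: leq_add => //; apply: h3; first by lia.
move=> w; rewrite !inE => /andP[_ wU].
by have := nbD _ wU; have := hd _ wU; lia.
Qed.

(* Kruskal-Katona for cliques, relative to a set S of vertices that may be
   joined to everything; the induction deletes a vertex of minimum degree in U
   and uses convexity of binomials.  The terms in 'C(#|S|, l) are placed so that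
   no lower bound on #|U| is needed. *)
Lemma card_cliques_in_Kruskal_Katona l (S U : {set V}) x y : [disjoint S & U] ->
  #|edges_in U| <= 'C(x, 2) + y -> y <= x ->
  #|cliques_in l.+1 (S :|: U)| + 'C(#|S|, l) * x.+1 <=
    'C(#|S| + x, l.+1) + 'C(#|S| + y, l) + 'C(#|S|, l) * #|U|.
Proof.
move En: #|U| => n; elim: n U En x y => [|n IH] U cU x y dSU eU yx.
  move/eqP: cU; rewrite cards_eq0 => /eqP ->; rewrite setU0 muln0 addn0.
  have := card_cliques_in_le l.+1 S; have := bin_add_lower l #|S| x.
  have : 'C(#|S|, l) <= 'C(#|S| + y, l) by apply: leq_bin2l; rewrite leq_addr.
  by rewrite mulnS mulnC; lia.
have /card_gt0P [v0 v0U] : 0 < #|U| by rewrite cU.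
pose v := [arg min_(i < v0 in U) #|nbhd i U|].
have [vU vmin] : v \in U /\ forall w, w \in U -> #|nbhd v U| <= #|nbhd w U|.
  by rewrite /v; case: arg_minnP => // i iU h; split=> // w /h.
set d := #|nbhd v U| in vmin.
have ed : 'C(d.+1, 2) <= #|edges_in U| by apply: edges_in_min_degree; rewrite ?cU.
have eE : #|edges_in U| = #|edges_in (U :\ v)| + d := card_edges_inD1 vU.
have vS : v \notin S by move/disjointFl: dSU => ->.
have SUD : (S :|: U) :\ v = S :|: (U :\ v).
  by apply/setP=> z; rewrite !inE; case: eqP => // ->; rewrite (negbTE vS).
have nbSU : #|nbhd v (S :|: U)| <= #|S| + d.
  apply: leq_trans (leq_card_setU _ _).1; apply: subset_leq_card.
  by apply/subsetP=> z; rewrite !inE => /andP[/orP[->|->] ->]; rewrite ?orbT.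
have := @card_cliques_inD1 l v (S :|: U); rewrite inE vU orbT SUD => /(_ isT) clD.
have : 'C(#|nbhd v (S :|: U)|, l) <= 'C(#|S| + d, l) by apply: leq_bin2l.
have cU' : #|U :\ v| = n by move: cU; rewrite (cardsD1 v) vU => -[].
have dSU' : [disjoint S & U :\ v].
  by apply: disjointWr dSU; apply: subsetDl.
have {}IH := IH _ cU' _ _ dSU'.
(* If [d <= y], the deleted edges are charged to [y] alone. Convexity trades the tops
   [#|S| + (y - d)] and [#|S| + d] for [#|S| + y] and [#|S|]; the last binomial is paid for by the
   extra vertex of [U]. *)
have [dy|yd] := leqP d y.
  have := IH x (y - d); have : #|edges_in (U :\ v)| <= 'C(x, 2) + (y - d) by lia.
  move=> -> /(_ isT); have -> : y - d <= x by lia.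
  move=> /(_ isT).
  have := @bin_convex l (#|S| + y) (#|S| + (y - d)) (#|S| + d) #|S|.
  by rewrite mulnS; lia.
(* If [x <= d], then ['C(d, 2) + d] is at most ['C(x, 2) + y], hence at most ['C(d, 2) + y], against
   [y < d]. *)
have dx : d < x.
  rewrite ltnNge; apply/negP=> xd; have := @leq_bin2l _ _ 2 xd.
  by move: ed; rewrite binS bin1; lia.
case: x => // x in eU yx dx *.
move: eU; rewrite binS bin1 => eU.
(* With [x] lowered by one, Pascal's rule frees [x] edges, so the remainder becomes [x + y - d],
   again at most [x] since [y < d]. *)
have := IH x (x + y - d); have : #|edges_in (U :\ v)| <= 'C(x, 2) + (x + y - d) by lia.
move=> -> /(_ isT); have -> : x + y - d <= x by lia.
move=> /(_ isT).
have := @bin_convex l (#|S| + x) (#|S| + (x + y - d)) (#|S| + d) (#|S| + y).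
by rewrite addnS binS !mulnS; lia.
Qed.

End Graph.

(** * Gallai's lemma and graphs of bounded matching number *)

Lemma set2I_single (T : finType) (A : {set T}) u w :
  u \notin A -> w \in A -> [set u; w] :&: A = [set w].
Proof.
move=> uA wA; apply/setP=> z; rewrite !inE.
have [->|zw] := eqVneq z w; rewrite ?wA ?orbT ?orbF //.
by apply: contraNF uA => /andP[/eqP <-].
Qed.

Section Matching.

Variables (V : finType) (G : {set {set V}}).
Hypothesis sG : simple_graph G.
Implicit Types (M N : {set {set V}}) (e f : {set V}).

Lemma matching_edge M e : matching G M -> e \in M -> #|e| = 2.
Proof. by case/andP=> /subsetP MG _ /MG; apply: edge_card. Qed.

Lemma card_cover_matching M : matching G M -> #|cover M| = #|M|.*2.
Proof.
move=> mM; have /andP[_ /eqP <-] := mM; rewrite -muln2 -sum_nat_const.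
by apply: eq_bigr => e; apply: matching_edge.
Qed.

Lemma matching_sub M N : N \subset M -> matching G M -> matching G N.
Proof.
move=> NM /andP[MG tM]; apply/andP; split; first exact: subset_trans MG.
exact: trivIsetS tM.
Qed.

Lemma matchingU1 M e : matching G M -> e \in G -> [disjoint e & cover M] ->
  matching G (e |: M) /\ e \notin M.
Proof.
move=> mM eG dM; have /andP[MG tM] := mM.
have [] := @trivIsetU1 _ e M _ tM.
- move=> f fM; apply: disjointWr dM; exact: (bigcup_sup f).
- by apply/negP=> /(matching_edge mM); rewrite cards0.
by move=> tU eM; split=> //; rewrite /matching tU subUset sub1set eG MG.
Qed.

Section Maximum.

Variable k : nat.
Hypothesis nuG : forall M, matching G M -> #|M| <= k.

(** Otherwise the edge could be added to [M]. *)
Lemma maximum_matching_edge M x y : matching G M -> #|M| = k ->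
  [set x; y] \in G -> x \notin cover M -> y \in cover M.
Proof.
move=> mM cM eG xM; apply: contraT => yM.
have [|mU eM] := matchingU1 mM eG.
  by rewrite disjoints_subset subUset !sub1set !inE xM.
by have := nuG mU; rewrite cardsU1 eM cM ltnn.
Qed.

(* The distance-two case of Gallai's lemma: among the maximum matchings N that
   miss w, take one sharing as many edges as possible with M. *)
Lemma missed_neighbour_unique M u u' w : matching G M -> #|M| = k ->
  u \notin cover M -> u' \notin cover M ->
  [set u; w] \in G -> [set u'; w] \in G ->
  (exists N, [/\ matching G N, #|N| = k & w \notin cover N]) -> u = u'.
Proof.
move=> mM cM uM u'M uw u'w [N0 [mN0 cN0 wN0]].
apply/eqP; apply: contraT => uu'.
pose P N := [&& matching G N, #|N| == k & w \notin cover N].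
have P0 : P N0 by rewrite /P mN0 cN0 eqxx.
have [N /and3P[mN /eqP cN wN] Nmax] :
    exists2 N, P N & forall N', P N' -> #|M :&: N'| <= #|M :&: N|.
  by case: (arg_maxnP (fun N => #|M :&: N|) P0) => N PN h; exists N.
have uN : u \in cover N by apply: (maximum_matching_edge mN cN _ wN); rewrite setUC.
have u'N : u' \in cover N by apply: (maximum_matching_edge mN cN _ wN); rewrite setUC.
(* The two covers have equal size and [N] covers [u] and [u'], which [M] misses. So [M] covers at
   least two vertices missed by [N], one of them, [x], different from [w]. *)
have : 1 < #|cover M :\: cover N|.
  rewrite !cardsD setIC card_cover_matching // cM -cN -card_cover_matching // -cardsD.
  have <- : #|[set u; u']| = 2 by rewrite cards2 uu'.
  apply: subset_leq_card.
  by rewrite subUset !sub1set !inE uN u'N uM u'M.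
rewrite (cardsD1 w) => two.
have /card_gt0P [x] : 0 < #|(cover M :\: cover N) :\ w|.
  by move: two; case: (w \in _); case: #|_|.
rewrite !inE => /and3P[xw xN xM].
case/bigcupP: xM => e eM xe; have eG : e \in G by case/andP: mM => /subsetP /(_ _ eM).
have /cards2P [a [b [ab E]]] : #|e| == 2 by rewrite (matching_edge mM).
have [y [Exy xy]] : exists y, e = [set x; y] /\ x != y.
  move: xe; rewrite E !inE => /orP[]/eqP ->; [exists b|exists a] => //.
  by rewrite setUC eq_sym.
have yN : y \in cover N by apply: (maximum_matching_edge mN cN _ xN); rewrite -Exy.
case/bigcupP: (yN) => f fN yf.
have ef : e != f by apply: contraNneq xN => ef; apply/bigcupP; exists f => //; rewrite -ef.
(* Exchange [f] for [e] in [N]. The new matching still misses [w], because [x != w] and [y] is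
   covered by [N]. It shares one more edge with [M], because [f] meets [e] in [y] and so is not in
   [M]. *)
have mNf : matching G (N :\ f) by apply: matching_sub mN; apply: subsetDl.
have cNf : cover (N :\ f) = cover N :\: f by apply: coverD1 => //; case/andP: mN.
have [|mN' eNf] := matchingU1 mNf eG.
  by rewrite cNf Exy disjoints_subset subUset !sub1set !inE (negbTE xN) andbF yf.
have eN : e \notin N by apply: contra eNf => eN; rewrite !inE ef.
have fM : f \notin M.
  apply: contraTN isT => fM; case/andP: mM => _ /trivIsetP /(_ _ _ eM fM ef).
  by rewrite disjoints_subset => /subsetP /(_ y); rewrite Exy !inE eqxx orbT yf => /(_ isT).
have := Nmax (e |: (N :\ f)); rewrite /P mN' cardsU1 eNf.
have <- : #|N| = 1 + #|N :\ f| by rewrite (cardsD1 f) fN.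
rewrite cN eqxx /=; have -> : w \notin cover (e |: N :\ f).
  rewrite /cover bigcup_setU big_set1 -/(cover _) cNf !inE (negbTE wN) andbF orbF.
  rewrite Exy !inE negb_or eq_sym xw /=; by apply: contraNneq wN => ->.
move=> /(_ isT); rewrite leqNgt => /negP []; apply: proper_card.
apply/properP; split.
  apply/subsetP=> g; rewrite !inE => /andP[gM gN]; rewrite gM gN andbT /=.
  by rewrite (_ : g != f) ?orbT //; apply: contraNneq fM => <-.
by exists e; rewrite !inE ?eqxx ?eM // (negbTE eN) andbF.
Qed.

(** Fix a matching [M] of size [k]. At most ['C(k.*2, 2)] edges lie inside its cover; every other
    edge has exactly one end there, and by [missed_neighbour_unique] each of the [k.*2] covered
    vertices is in at most one such edge. *)
Lemma card_edges_no_essential :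
  (forall v, exists N, [/\ matching G N, #|N| = k & v \notin cover N]) ->
  #|G| <= 'C(k.*2.+1, 2).
Proof.
move=> miss; have [->|[e0 e0G]] := set_0Vmem G; first by rewrite cards0.
have /card_gt0P [v0 _] : 0 < #|e0| by rewrite (edge_card sG).
have [M [mM cM _]] := miss v0.
have cC : #|cover M| = k.*2 by rewrite card_cover_matching // cM.
rewrite -(cardsID [set e : {set V} | e \subset cover M]) binS bin1; apply: leq_add.
  rewrite -cC -cards_draws; apply: subset_leq_card; apply/subsetP=> e.
  by rewrite !inE => /andP[eG ->]; rewrite (edge_card sG).
have cross e : e \in G :\: [set e : {set V} | e \subset cover M] ->
  exists u w, [/\ e = [set u; w], u \notin cover M & w \in cover M].
  rewrite !inE => /andP[eM eG]; have /cards2P [a [b [ab E]]] : #|e| == 2.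
    by rewrite (edge_card sG).
  have [aM|aM] := boolP (a \in cover M).
    exists b, a; split=> //; first by rewrite setUC.
    by apply: contra eM => bM; rewrite E subUset !sub1set aM.
  by exists a, b; split=> //; apply: maximum_matching_edge aM; rewrite -?E.
rewrite -cC -(card_in_imset (f := fun e => e :&: cover M)); last first.
  move=> e e' De De'; have [u [w [E uM wM]]] := cross _ De.
  have [u' [w' [E' u'M w'M]]] := cross _ De'.
  rewrite E E' !set2I_single // => /set1_inj ww'; subst w'.
  suff -> : u = u' by [].
  move: De De'; rewrite !inE E E' => /andP[_ eG] /andP[_ e'G].
  exact: (missed_neighbour_unique mM cM uM u'M eG e'G (miss w)).
apply: leq_trans (_ : #|[set [set w] | w in cover M]| <= _).
  apply: subset_leq_card; apply/subsetP=> _ /imsetP[e De ->].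
  have [u [w [-> uM wM]]] := cross _ De; apply/imsetP; exists w => //; exact: set2I_single.
exact: leq_imset_card.
Qed.

End Maximum.

End Matching.

(* Vertices covered by all maximum matchings are moved to S one at a time; a
   graph without such vertices is handled by card_edges_no_essential. *)
Lemma bounded_matching_structure (V : finType) (G : {set {set V}}) k :
  simple_graph G -> (forall M, matching G M -> #|M| <= k) ->
  exists S : {set V}, exists r,
    #|S| + r <= k /\ #|[set e in G | [disjoint e & S]]| <= 'C(r.*2.+1, 2).
Proof.
elim: k G => [|k IH] G sG nuG.
  exists set0, 0; rewrite cards0; split=> //.
  apply: leq_trans (card_edges_no_essential sG nuG _).
    by apply: subset_leq_card; apply/subsetP=> e; rewrite inE => /andP[].
  move=> v; exists set0; split; rewrite ?cards0 ///cover ?big_set0 ?inE //.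
  by rewrite /matching sub0set /trivIset /cover !big_set0 cards0.
(* The number [k.+1] is only an upper bound. If no matching attains it, the condition on [v] holds
   vacuously, and deleting any [v] still leaves matchings of size at most [k]. *)
have [/existsP[v /forallP ess]|ness] := boolP [exists v, [forall M : {set {set V}},
    (matching G M && (#|M| == k.+1)) ==> (v \in cover M)]].
  pose G' := [set e in G | v \notin e].
  have sG' : simple_graph G'.
    by apply/forall_inP=> e; rewrite inE => /andP[eG _]; rewrite (edge_card sG).
  have nuG' M : matching G' M -> #|M| <= k.
    move=> /andP[MG' tM]; have mM : matching G M.
      rewrite /matching tM andbT; apply/subsetP=> e /(subsetP MG').
      by rewrite inE => /andP[].
    have := nuG _ mM; rewrite leq_eqVlt => /orP[cM|//].
    have := ess M; rewrite mM cM => /bigcupP[e /(subsetP MG')].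
    by rewrite inE => /andP[_ /negbTE ->].
  have [S [r [h1 h2]]] := IH _ sG' nuG'; exists (v |: S), r; split.
    by rewrite cardsU1; case: (_ \notin _) => /=; lia.
  apply: leq_trans h2; apply: subset_leq_card; apply/subsetP=> e.
  rewrite !inE !disjoints_subset setCU subsetI => /and3P[-> + ->].
  by rewrite subsetC sub1set inE => ->.
exists set0, k.+1; rewrite cards0; split=> //.
apply: leq_trans (card_edges_no_essential sG nuG _).
  by apply: subset_leq_card; apply/subsetP=> e; rewrite inE => /andP[].
move=> v; move: ness; rewrite negb_exists => /forallP/(_ v).
rewrite negb_forall => /existsP[M]; rewrite negb_imply => /andP[/andP[mM /eqP cM] vM].
by exists M.
Qed.

(** * Structure of graphs with a colouring that avoids all the matchings *)

Lemma exists_subset_card (T : finType) (A : {set T}) m : m <= #|A| ->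
  exists2 B : {set T}, B \subset A & #|B| = m.
Proof.
rewrite -bin_gt0 -cards_draws => /card_gt0P[B]; rewrite inE => /andP[BA /eqP cB].
by exists B.
Qed.

Lemma exists_superset_card (T : finType) (A : {set T}) m : #|A| <= m <= #|T| ->
  exists2 B : {set T}, A \subset B & #|B| = m.
Proof.
case/andP=> Am mT; have cA := cardsC A.
have [|B BA cB] := @exists_subset_card T (~: A) (m - #|A|); first by lia.
exists (A :|: B); first exact: subsetUl.
have /eqP -> : #|A :|: B| == #|A| + #|B|.
  by rewrite (leq_card_setU A B).2 disjoint_sym disjoints_subset.
by lia.
Qed.

(** The colour classes are treated separately by [bounded_matching_structure]. An edge avoiding the
    union of the resulting sets avoids the set of its own colour, so the edge bounds add up;
    enlarging the union only removes edges from its complement. *)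
Lemma non_arrow_structure (V : finType) (G : {set {set V}}) q (t : 'I_q -> nat) :
  simple_graph G -> ~~ arrows G t -> (forall j, 0 < t j) -> Lambda t <= #|V| ->
  exists S : {set V}, exists r : 'I_q -> nat,
    [/\ forall j, r j < t j, #|S| + \sum_j r j = Lambda t
      & #|edges_in G (~: S)| <= \sum_j 'C((r j).*2.+1, 2)].
Proof.
move=> sG; rewrite negb_forall => /existsP[c].
rewrite negb_exists => /forallP nar ht LV.
pose Gc j := [set e in G | c e == j].
have sGc j : simple_graph (Gc j).
  by apply/forall_inP=> e; rewrite inE => /andP[eG _]; rewrite (edge_card sG).
have nuGc j M : matching (Gc j) M -> #|M| <= t j - 1.
  move=> mM; rewrite -ltnS subn1 prednK // ltnNge; apply/negP => tM.
  have [N NM cN] := exists_subset_card tM.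
  have /andP[NG tN] := matching_sub NM mM.
  have := nar j; rewrite negb_exists => /forallP/(_ N)/negP; apply.
  rewrite cN eqxx /=; apply/andP; split.
    rewrite /matching tN andbT; apply/subsetP=> e /(subsetP NG).
    by rewrite inE => /andP[].
  by apply/forall_inP=> e /(subsetP NG); rewrite inE => /andP[].
have /fin_all_exists [S0 /fin_all_exists [r hr]] :=
  fun j => bounded_matching_structure (sGc j) (nuGc j).
have cS : #|\bigcup_j S0 j| + \sum_j r j <= Lambda t.
  apply: leq_trans (_ : \sum_j (#|S0 j| + r j) <= _); last first.
    by apply: leq_sum => j _; case: (hr j).
  rewrite big_split leq_add2r /=.
  elim/big_rec2: _ => [|j m A _ IH]; first by rewrite cards0.
  by apply: leq_trans (leq_card_setU _ _).1 _; rewrite leq_add2l.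
have [|S SS cS'] := @exists_superset_card V (\bigcup_j S0 j) (Lambda t - \sum_j r j).
  by lia.
exists S, r; split; last 1 first.
- apply: leq_trans (_ : #|\bigcup_j [set e in Gc j | [disjoint e & S0 j]]| <= _).
    apply: subset_leq_card; apply/subsetP=> e; rewrite inE => /andP[eG eS].
    apply/bigcupP; exists (c e) => //; rewrite !inE eG eqxx /=.
    apply: disjointWr (_ : [disjoint e & S]); last by rewrite disjoints_subset.
    by apply: subset_trans SS; apply: (bigcup_sup (c e)).
  apply: leq_trans (_ : \sum_j #|[set e in Gc j | [disjoint e & S0 j]]| <= _).
    elim/big_rec2: _ => [|j m A _ IH]; first by rewrite cards0.
    by apply: leq_trans (leq_card_setU _ _).1 _; rewrite leq_add2l.
  by apply: leq_sum => j _; case: (hr j).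
- by move=> j; have := (hr j).1; have := ht j; lia.
- by lia.
Qed.

(** * Numerical optimisation *)

Lemma double_bin2 n : ('C(n.+1, 2)).*2 = n.+1 * n.
Proof. by elim: n => // n IH; rewrite binS bin1 doubleD IH; lia. Qed.

Lemma sum_bin2_odd_le (I : finType) (r : I -> nat) a :
  (forall i, r i <= a) -> a <= \sum_i r i ->
  \sum_i 'C((r i).*2.+1, 2) <= 'C((\sum_i r i + a).+1, 2).
Proof.
move=> ra aR; apply: leq_trans (_ : (\sum_i r i) * a.*2.+1 <= _).
  rewrite big_distrl /=; apply: leq_sum => i _; rewrite bin2_odd leq_mul2l.
  by rewrite ltnS leq_double ra orbT.
(* Writing [R] as [h + a], twice the difference of the two sides is [h * (h - 1)]. *)
move: (\sum_i r i) aR => R aR; rewrite -leq_double double_bin2.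
by rewrite -(subnK aR); move: (R - a) => h; nia.
Qed.

Lemma quasiconvex_le_max (F : nat -> nat) T :
  (forall a, a.+2 <= T -> F a <= F a.+1 -> F a.+1 <= F a.+2) ->
  forall a, a <= T -> F a <= maxn (F 0) (F T).
Proof.
elim: T => [|T IH] step a aT.
  by move: aT; rewrite leqn0 => /eqP ->; rewrite leq_maxl.
(* If the last step descends strictly, then by [step] so do all earlier ones, whence
   [F T <= F 0]. *)
have last_step : F T <= F T.+1 \/ F T.+1 < F T /\ F T <= F 0.
  elim: {IH a aT} T step => [|T IH] step; first by lia.
  have := step T; have := IH (fun a aT => step a (leqW aT)); lia.
have [->|aT'] := eqVneq a T.+1; first exact: leq_maxr.
have := IH (fun a aT => step a (leqW aT)) a; lia.
Qed.

(** As [a] grows, each step gains more in the first binomial and loses less in the product term, so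
    a step that does not descend is followed by another such step. *)
Lemma phi_le_max l n L T a : 2 <= l -> T <= L -> L + T < n -> a <= T ->
  phi l n a.*2.+1 (L - a) <= maxn (phi l n 1 L) (phi l n T.*2.+1 (L - T)).
Proof.
case: l => [|[|m]] // _ TL Ln aT.
have := @quasiconvex_le_max (fun a => phi m.+2 n a.*2.+1 (L - a)) T.
rewrite subn0; apply=> // {aT}a aT; rewrite /phi !subn1 /=.
have -> : a.*2.+1 + (L - a) = (L + a).+1 by lia.
have -> : a.+1.*2.+1 + (L - a.+1) = (L + a).+2 by lia.
(* No subtraction is truncated, since [a.+2 <= T], [T <= L] and [L + T < n]. *)
have -> : a.+2.*2.+1 + (L - a.+2) = (L + a).+3 by lia.
pose D := n - (L + a).+3.
have -> : n - a.*2.+1 - (L - a) = D.+2 by lia.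
have -> : n - a.+1.*2.+1 - (L - a.+1) = D.+1 by lia.
have -> : n - a.+2.*2.+1 - (L - a.+2) = D by lia.
have -> : L - a = (L - a.+2).+2 by lia.
have -> : L - a.+1 = (L - a.+2).+1 by lia.
move: (L - a.+2) D => b D.
rewrite (binS (L + a).+2 m.+1) (binS (L + a).+1 m.+1) (binS b.+1 m) (binS b m).
have := leq_bin2l m (leqnSn b); have := leq_bin2l m.+1 (leqnSn (L + a).+1).
by rewrite !mulnS !mulnDl; nia.
Qed.

(** * The upper bound *)

Lemma leq_tmax q (t : 'I_q -> nat) j : t j <= tmax t.
Proof. exact: leq_bigmax. Qed.

Lemma tmax_attained q (t : 'I_q -> nat) : 0 < q -> exists j, tmax t = t j.
Proof. by move=> q0; have [|j E] := @eq_bigmax _ t; [rewrite card_ord|exists j]. Qed.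

Lemma leq_Lambda q (t : 'I_q -> nat) j : t j - 1 <= Lambda t.
Proof. by rewrite /Lambda (bigD1 j) //= leq_addr. Qed.

Lemma num_cliques_upper (V : finType) (G : {set {set V}}) q l (t : 'I_q -> nat) :
  0 < q -> 2 <= l -> (forall j, 0 < t j) -> tmax t + Lambda t <= #|V| ->
  simple_graph G -> ~~ arrows G t ->
  num_cliques l G <= maxn (phi l #|V| 1 (Lambda t))
    (phi l #|V| (tmax t).-1.*2.+1 (Lambda t - (tmax t).-1)).
Proof.
move=> q0 l2 ht hn sG nar; have [j0 j0E] := tmax_attained t q0.
have T0 : 0 < tmax t by rewrite j0E.
have TL : (tmax t).-1 <= Lambda t by rewrite j0E -subn1 leq_Lambda.
have [|S [r [rt cS eS]]] := non_arrow_structure sG nar ht; first by lia.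
set R := \sum_j r j in cS.
pose a := minn R (tmax t).-1.
have ra j : r j <= a.
  rewrite leq_min /R (bigD1 j) //= leq_addr /=.
  by have := rt j; have := leq_tmax t j; lia.
have aR : a <= R by apply: geq_minl.
have aT : a <= (tmax t).-1 by apply: geq_minr.
apply: leq_trans (phi_le_max (n := #|V|) l2 TL _ aT); last by lia.
case: l l2 => // l l2.
have dS : [disjoint S & ~: S] by rewrite disjoints_subset setCK.
(* The choice [x = (R + a).+1], [y = 0] matches the edge bound and makes [#|S| + x] equal to
   [(Lambda t + a).+1], the first top in [phi]. *)
have := @card_cliques_in_Kruskal_Katona _ _ sG l S (~: S) (R + a).+1 0 dS.
rewrite addn0 (leq_trans eS (sum_bin2_odd_le ra aR)) => /(_ isT isT).
rewrite addn0 setUCr /phi subn1 /=.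
have -> : cliques_in G l.+1 setT = [set K : {set V} | (#|K| == l.+1) && clique G K].
  by apply/setP=> K; rewrite !inE subsetT.
rewrite -/(num_cliques _ _).
have -> : #|S| + (R + a).+1 = a.*2.+1 + (Lambda t - a) by lia.
have cC := cardsC S.
have -> : #|~: S| = (#|V| - a.*2.+1 - (Lambda t - a)) + (R + a).+1 by lia.
(* After cancellation ['C(#|S|, l)] is multiplied by [#|V| - (Lambda t + a).+1]; since [#|S|] is
   [Lambda t - R] and [a <= R], its top may be raised to [Lambda t - a]. *)
have : 'C(#|S|, l) <= 'C(Lambda t - a, l) by apply: leq_bin2l; lia.
move: ('C(#|S|, l)) ('C(Lambda t - a, l)) => x y xy.
move: (R + a) (#|V| - _ - _) => u D.
by have := leq_mul xy (leqnn D); rewrite mulnDr !mulnS; lia.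
Qed.

(** * The extremal construction *)

(** Greedy assignment: if every class were full, the elements already placed would exhaust the total
    capacity, leaving no room for the next one. *)
Lemma capacity_assignment (T I : finType) (i0 : I) (cap : I -> nat) (S : {set T}) :
  #|S| <= \sum_i cap i ->
  exists f : T -> I, forall i, #|[set v in S | f v == i]| <= cap i.
Proof.
move En: #|S| => n; elim: n S En => [|n IH] S cS hS.
  exists (fun=> i0) => i; rewrite (_ : [set _ in _ | _] = set0) ?cards0 //.
  by apply/setP=> v; rewrite (cards0_eq cS) !inE.
have /card_gt0P [v vS] : 0 < #|S| by rewrite cS.
have cS' : #|S :\ v| = n by move: cS; rewrite (cardsD1 v) vS => -[].
have [f hf] := IH _ cS' (ltnW hS).
have [i hi] : exists i, #|[set w in S :\ v | f w == i]| < cap i.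
  apply/existsP; apply: contraTT hS; rewrite negb_exists => /forallP h.
  rewrite -leqNgt -cS' -sum1_card (partition_big f predT) //=.
  apply: leq_sum => i _; have := h i; rewrite -leqNgt => /leq_trans; apply.
  by rewrite -sum1_card; apply: eq_leq; apply: eq_bigl => w; rewrite !inE.
exists (fun w => if w == v then i else f w) => i'.
have [->|ii'] := eqVneq i' i.
  apply: leq_trans hi; apply: leq_trans (_ : #|v |: [set w in S :\ v | f w == i]| <= _).
    by apply: subset_leq_card; apply/subsetP=> w; rewrite !inE; case: (w == v).
  by rewrite cardsU1; case: (_ \notin _).
apply: leq_trans (hf i'); apply: subset_leq_card; apply/subsetP=> w.
by rewrite !inE; case: (w == v) => //; rewrite eq_sym (negbTE ii') andbF.
Qed.

Section Construction.

Variables (V : finType) (S A : {set V}).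

(** [A] spans a clique and the vertices of [S] are joined to everything. With [S] inside [A] and
    sizes [Lambda t - a] and [(Lambda t + a).+1], this is the extremal graph. *)
Definition split_graph : {set {set V}} :=
  [set e : {set V} | (#|e| == 2) && ((e \subset A) || ~~ [disjoint e & S])].

Lemma simple_split_graph : simple_graph split_graph.
Proof. by apply/forall_inP=> e; rewrite inE => /andP[]. Qed.

(* Edges meeting S take the colour of one of their vertices in S, all other
   edges the colour with the largest entry of t. *)
Lemma split_graph_not_arrows q (t : 'I_q -> nat) a :
  0 < q -> (forall j, 0 < t j) -> a < tmax t ->
  #|S| + a <= Lambda t -> #|A :\: S| <= a.*2.+1 -> ~~ arrows split_graph t.
Proof.
move=> q0 ht aT cS cA; have [j0 j0E] := tmax_attained t q0.
(* Colour [j0] reserves [a] of its [t j0 - 1] permitted matching edges for the edges that avoid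
   [S]. *)
pose cap j := t j - 1 - (if j == j0 then a else 0).
have capE : \sum_j cap j + a = Lambda t.
  rewrite /Lambda (bigD1 j0) //= [RHS](bigD1 j0) //= /cap eqxx.
  rewrite (eq_bigr (fun j => t j - 1)) => [|j /negbTE ->]; last by rewrite subn0.
  by rewrite j0E in aT; lia.
have [|f hf] := @capacity_assignment V _ j0 cap S; first by lia.
pose c : {ffun {set V} -> 'I_q} :=
  [ffun e => if [pick v in e :&: S] is Some v then f v else j0].
rewrite negb_forall; apply/existsP; exists c; rewrite negb_exists.
apply/forallP=> j; rewrite negb_exists; apply/forallP=> M.
apply/negP=> /and3P[mM /eqP cM /forall_inP colM].
suff : #|M| <= t j - 1 by have := ht j; lia.
have /andP[MG tM] := mM.
rewrite -(cardsID [set e : {set V} | [disjoint e & S]]).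
set M1 := _ :&: _; set M2 := _ :\: _.
have c2 : #|M2| <= cap j.
  apply: leq_trans (hf j).
  (* The vertex of [S] deciding the colour of an edge is distinct for disjoint edges, which embeds
     [M2] in the vertices assigned to [j]. The value [None] never occurs on [M2]. *)
  pose g (e : {set V}) := if [pick v in e :&: S] is Some v then Some v else None.
  have gP e : e \in M2 -> exists v, [/\ g e = Some v, v \in e, v \in S & f v = j].
    rewrite !inE => /andP[eS eM]; have := colM e eM; rewrite ffunE /g.
    case: pickP => [v /setIP[ve vS] /eqP fv|none]; first by exists v.
    by case/pred0Pn: eS => v /= vI; move: (none v); rewrite inE vI.
  rewrite -(card_in_imset (f := g)); last first.
    move=> e e' eM e'M; have [v [-> ve _ _]] := gP e eM; have [v' [-> v'e _ _]] := gP e' e'M.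
    move=> [vv']; subst v'; apply/eqP; apply: contraT => ee'.
    have /trivIsetP := tM => /(_ e e').
    move: eM e'M; rewrite !inE => /andP[_ ->] /andP[_ ->] /(_ isT isT ee').
    by rewrite disjoints_subset => /subsetP /(_ v ve); rewrite inE v'e.
  rewrite -[leqRHS](card_imset _ (@Some_inj _)); apply: subset_leq_card.
  apply/subsetP=> _ /imsetP[e eM ->]; have [v [-> ve vS fv]] := gP e eM.
  by apply/imsetP; exists v; rewrite // inE vS fv eqxx.
have M1P e : e \in M1 -> e \subset A :\: S /\ j = j0.
  rewrite !inE => /andP[eM eS]; split.
    have := subsetP MG e eM; rewrite inE eS orbF => /andP[_ eA].
    by rewrite subsetD eA.
  have := colM e eM; rewrite ffunE; case: pickP => [v /setIP[ve vS]|_ /eqP //].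
  by move: eS; rewrite disjoints_subset => /subsetP/(_ v ve); rewrite inE vS.
have mM1 : matching split_graph M1 by apply: matching_sub mM; apply: subsetIl.
(* The edges of [M1] are disjoint pairs among the at most [a.*2.+1] vertices of [A :\: S]. *)
have c1 : #|M1| <= a.
  have : #|cover M1| <= a.*2.+1.
    apply: leq_trans cA; apply: subset_leq_card; apply/bigcupsP=> e.
    by case/M1P.
  by rewrite (card_cover_matching simple_split_graph mM1) leq_Sdouble.
have [E|[e /M1P[_ jj0]]] := set_0Vmem M1.
  by rewrite E cards0; move: c2; rewrite /cap; lia.
by move: c2; rewrite /cap jj0 eqxx -j0E; lia.
Qed.

Lemma num_cliques_split_graph l : S \subset A ->
  'C(#|A|, l.+1) + 'C(#|S|, l) * (#|V| - #|A|) <= num_cliques l.+1 split_graph.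
Proof.
move=> SA.
pose X := [set K : {set V} | K \subset A & #|K| == l.+1].
(* Besides the cliques inside [A] there are those made of one vertex outside [A] and [l] vertices of
   [S]; intersecting with [A] recovers the part in [S]. *)
pose Y := (fun p : V * {set V} => p.1 |: p.2) @:
  setX (~: A) [set K : {set V} | K \subset S & #|K| == l].
have Yinj : {in setX (~: A) [set K : {set V} | K \subset S & #|K| == l] &,
    injective (fun p : V * {set V} => p.1 |: p.2)}.
  move=> [v K] [w L]; rewrite !inE /= => /andP[vA /andP[KS _]] /andP[wA /andP[LS _]] E.
  have recA z (Z : {set V}) : z \notin A -> Z \subset S -> (z |: Z) :&: A = Z.
    move=> zA ZS; rewrite setIUl (setIidPl (subset_trans ZS SA)).
    by rewrite (_ : [set z] :&: A = set0) ?set0U //; apply/eqP; rewrite setI_eq0 disjoints1.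
  have KL : K = L by rewrite -(recA _ _ vA KS) E recA.
  subst L; congr pair; apply/set1P; have := setU11 v K; rewrite E !inE.
  by case/orP=> // /(subsetP KS) /(subsetP SA); rewrite (negbTE vA).
have cX : #|X| = 'C(#|A|, l.+1) by rewrite cards_draws.
have cY : #|Y| = 'C(#|S|, l) * (#|V| - #|A|).
  by rewrite card_in_imset // cardsX cards_draws mulnC; congr (_ * _); have := cardsC A; lia.
rewrite -cX -cY; have /eqP <- : #|X :|: Y| == #|X| + #|Y|.
  rewrite (leq_card_setU X Y).2 disjoints_subset; apply/subsetP=> K; rewrite !inE => /andP[KA _].
  apply/negP=> /imsetP[[v L]]; rewrite !inE /= => /andP[vA _] E.
  by move/subsetP: KA => /(_ v); rewrite E setU11 (negbTE vA) => /(_ isT).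
apply: subset_leq_card; apply/subsetP=> K; rewrite !inE => /orP[/andP[KA ->]|] /=.
  apply/forall_inP=> x xK; apply/forall_inP=> y yK; apply/implyP=> xy.
  by rewrite inE cards2 xy subUset !sub1set !(subsetP KA).
case/imsetP=> [[v L]]; rewrite !inE /= => /andP[vA /andP[LS /eqP cL]] ->.
have vL : v \notin L by apply: contra vA => /(subsetP LS) /(subsetP SA).
rewrite cardsU1 vL cL eqxx /=.
apply/forall_inP=> x xK; apply/forall_inP=> y yK; apply/implyP=> xy.
rewrite inE cards2 xy /=; apply/orP; right.
move: xK yK xy; rewrite !inE disjoints_subset subUset !sub1set !inE negb_and !negbK.
case/orP=> [/eqP->|/(subsetP LS) -> //]; case/orP=> [/eqP->|/(subsetP LS) ->]; rewrite ?orbT //.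
by rewrite eqxx.
Qed.

End Construction.

(** [S] and [A] stay general because for small [n] the set [A] is the whole vertex set, possibly
    with fewer than [(Lambda t + a).+1] vertices. *)
Lemma GRT_lower l n q (t : 'I_q -> nat) (S A : {set 'I_n}) a :
  0 < q -> (forall j, 0 < t j) -> a < tmax t -> S \subset A ->
  #|S| + a <= Lambda t -> #|A :\: S| <= a.*2.+1 ->
  'C(#|A|, l.+1) + 'C(#|S|, l) * (n - #|A|) <= GRT l.+1 n t.
Proof.
move=> q0 ht aT SA cS cA; have := num_cliques_split_graph l SA; rewrite card_ord.
move/leq_trans; apply; apply: (leq_bigmax_cond (split_graph S A)).
by rewrite simple_split_graph (split_graph_not_arrows q0 ht aT).
Qed.

Lemma GRT_ge_phi l n q (t : 'I_q -> nat) a :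
  0 < q -> (forall j, 0 < t j) -> a < tmax t -> tmax t + Lambda t <= n ->
  phi l.+1 n a.*2.+1 (Lambda t - a) <= GRT l.+1 n t.
Proof.
move=> q0 ht aT hn.
have [j0 j0E] := tmax_attained t q0; have TL := leq_Lambda t j0.
have [|A _ cA] := @exists_subset_card _ [set: 'I_n] (Lambda t + a).+1.
  by rewrite cardsT card_ord; lia.
have [|S SA cS] := @exists_subset_card _ A (Lambda t - a); first by lia.
have := @GRT_lower l n q t S A a q0 ht aT SA.
have -> : #|A :\: S| = a.*2.+1 by rewrite cardsD (setIidPr SA); lia.
rewrite /phi cA cS subn1 /=.
have -> : a.*2.+1 + (Lambda t - a) = (Lambda t + a).+1 by lia.
have -> : n - a.*2.+1 - (Lambda t - a) = n - (Lambda t + a).+1 by lia.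
by apply=> //; lia.
Qed.

(** * The trivial bound and the three ranges of [n] *)

Lemma GRT_le_bin l n q (t : 'I_q -> nat) : GRT l n t <= 'C(n, l).
Proof.
apply/bigmax_leqP=> G _; rewrite -[n in 'C(n, l)]card_ord -card_draws.
by apply: subset_leq_card; apply/subsetP=> K; rewrite !inE => /andP[].
Qed.

Theorem theorem1p2 (q l : nat) (t : 'I_q -> nat)
    (hq : 1 <= q) (hl : 2 <= l) (ht : forall j : 'I_q, 0 < t j) :
  (forall n : nat, maxn l (tmax t + Lambda t) <= n ->
     GRT l n t = maxn (phi l n 1 (Lambda t))
                      (phi l n (2 * tmax t - 1) (Lambda t + 1 - tmax t)))
  /\ (forall n : nat, n < l -> GRT l n t = 0)
  /\ (forall n : nat, l <= n <= tmax t + Lambda t -> GRT l n t = 'C(n, l)).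
Proof.
have [j0 j0E] := tmax_attained t hq; have TL := leq_Lambda t j0.
have T0 : 0 < tmax t by rewrite j0E.
split=> [n|].
  rewrite geq_max => /andP[_ hn].
  (* Both entries of the maximum take the form [phi l n a.*2.+1 (Lambda t - a)], with [a = 0] and
     [a = (tmax t).-1]. *)
  have -> : 2 * tmax t - 1 = (tmax t).-1.*2.+1 by lia.
  have -> : Lambda t + 1 - tmax t = Lambda t - (tmax t).-1 by lia.
  apply/eqP; rewrite eqn_leq geq_max; apply/and3P; split.
  - apply/bigmax_leqP=> G /andP[sG nar].
    by have := @num_cliques_upper _ G q l t hq hl ht; rewrite card_ord; apply.
  - case: l hl => // l _; have := @GRT_ge_phi l n q t 0 hq ht T0 hn.
    by rewrite subn0.
  - by case: l hl => // l _; apply: GRT_ge_phi => //; lia.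
split=> n.
  by move=> nl; apply/eqP; rewrite -leqn0 -(bin_small nl); apply: GRT_le_bin.
case/andP=> _ hn; apply/eqP; rewrite eqn_leq GRT_le_bin /=; case: l hl => // l _.
(* With [A] the whole vertex set the graph is complete. As [n <= tmax t + Lambda t], at most
   [(tmax t).-1.*2.+1] vertices remain outside [S]. *)
have [|S SA cS] := @exists_subset_card _ [set: 'I_n] (minn n (Lambda t - (tmax t).-1)).
  by rewrite cardsT card_ord geq_minl.
have := @GRT_lower l n q t S setT (tmax t).-1 hq ht.
rewrite cardsT card_ord => h; apply: leq_trans (h _ SA _ _); first exact: leq_addr.
- by lia.
- by lia.
- by rewrite cardsD setTI cardsT card_ord cS; lia.
Qed.
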